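(* Let $a_1,\dots,a_8\ge0$ be real numbers such that the matrix $A$ defined in the context has rank $4$, and let $s_1,\dots,s_9>0$ be the values corresponding to the first nine natural frequencies (i.e. the first nine positive eigenvalues) of the problem $$y^{(4)}=s^2y \text{ on } [0,1],\quad -a_1y(0)+a_4y'''(0)=0,\quad -a_2y'(0)+a_3y''(0)=0,\quad a_5y(1)+a_8y'''(1)=0,\quad a_6y'(1)+a_7y''(1)=0.$$ Suppose that the $9\times 10$ matrix whose $i$-th row ($i=1,\dots,9$) is $$\Big(\tfrac{f^-(s_i)}{s_i^2},\ f^-(s_i),\ s_i^2f^-(s_i),\ f^+(s_i),\ \tfrac{z(s_i)}{s_i},\ s_iz(s_i),\ \tfrac{g^-(s_i)}{\sqrt{s_i}},\ \sqrt{s_i^3}\,g^-(s_i),\ \tfrac{g^+(s_i)}{\sqrt{s_i^3}},\ \sqrt{s_i}\,g^+(s_i)\Big)$$ has rank $9$. Then the inverse problem of reconstructing the boundary conditions from $s_1,\dots,s_9$ has a dual solution, in the following sense: if $\widetilde a_1,\dots,\widetilde a_8\ge0$ are real numbers such that the corresponding matrix $\widetilde A$ has rank $4$ and $s_1,\dots,s_9$ are also the values corresponding to the first nine natural frequencies of the problem $$y^{(4)}=s^2y \text{ on } [0,1],\quad -\widetilde a_1y(0)+\widetilde a_4y'''(0)=0,\quad -\widetilde a_2y'(0)+\widetilde a_3y''(0)=0,\quad \widetilde a_5y(1)+\widetilde a_8y'''(1)=0,\quad \widetilde a_6y'(1)+\widetilde a_7y''(1)=0,$$ then $A$ is linearly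 equivalent to $\widetilde A$ or $A$ is linearly equivalent to $\widetilde A^*$.
   Context: The functions are, for $s>0$, $$f^\pm(s)=\tfrac12\big(1\pm\cos\sqrt s\,\cosh\sqrt s\big),\quad z(s)=\tfrac12\sin\sqrt s\,\sinh\sqrt s,\quad g^\pm(s)=\tfrac12\big(-\sin\sqrt s\,\cosh\sqrt s\pm\cos\sqrt s\,\sinh\sqrt s\big).$$ The matrices are $$A=\begin{pmatrix} a_1&0&0&a_4&0&0&0&0\\ 0&a_2&a_3&0&0&0&0&0\\ 0&0&0&0&a_5&0&0&a_8\\ 0&0&0&0&0&a_6&a_7&0\end{pmatrix},\qquad \widetilde A=\begin{pmatrix} \widetilde a_1&0&0&\widetilde a_4&0&0&0&0\\ 0&\widetilde a_2&\widetilde a_3&0&0&0&0&0\\ 0&0&0&0&\widetilde a_5&0&0&\widetilde a_8\\ 0&0&0&0&0&\widetilde a_6&\widetilde a_7&0\end{pmatrix},$$ $$\widetilde A^*=\begin{pmatrix} \widetilde a_5&0&0&\widetilde a_8&0&0&0&0\\ 0&\widetilde a_6&\widetilde a_7&0&0&0&0&0\\ 0&0&0&0&\widetilde a_1&0&0&\widetilde a_4\\ 0&0&0&0&0&\widetilde a_2&\widetilde a_3&0\end{pmatrix}.$$ Two $4\times 8$ matrices $B,B'$ are linearly equivalent if $B'=SB$ for some invertible $4\times4$ matrix $S$ (i.e. they define the same system of linear boundary conditions). A number $s>0$ is a positive eigenvalue of the boundary value problem if the problem has a nontrivial solution $y$ for this $s$; the natural frequencies $\omega_i$ of the rod correspond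 to the positive eigenvalues $s_i$, listed in increasing order, via $s_i^2=\rho F\omega_i^2/\alpha$ with fixed positive constants $\rho,F,\alpha$. *)

(* Defs.v *)
From HB Require Import structures.
From mathcomp Require Import all_boot all_order all_algebra.
From mathcomp Require Import all_classical all_reals all_analysis.
Set Implicit Arguments.
Unset Strict Implicit.
Unset Printing Implicit Defensive.
Import Order.TTheory GRing.Theory Num.Theory.
Import numFieldNormedType.Exports.
Local Open Scope classical_set_scope.
Local Open Scope ring_scope.

Section Defs.
Variable R : realType.
Implicit Types (a : 'I_8 -> R) (s x : R) (y : R -> R).

Definition cosh x : R := (expR x + expR (- x)) / 2.
Definition sinh x : R := (expR x - expR (- x)) / 2.

Definition fplus s : R := (1 + cos (Num.sqrt s) * cosh (Num.sqrt s)) / 2.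
Definition fminus s : R := (1 - cos (Num.sqrt s) * cosh (Num.sqrt s)) / 2.
Definition z s : R := sin (Num.sqrt s) * sinh (Num.sqrt s) / 2.
Definition gplus s : R :=
  (- (sin (Num.sqrt s) * cosh (Num.sqrt s))
   + cos (Num.sqrt s) * sinh (Num.sqrt s)) / 2.
Definition gminus s : R :=
  (- (sin (Num.sqrt s) * cosh (Num.sqrt s))
   - cos (Num.sqrt s) * sinh (Num.sqrt s)) / 2.

(* The coefficients a_1, ..., a_8 are numbered from 1, ordinals from 0;
   [coef a k] is a_k and is only used for 1 <= k <= 8. *)
Definition coef a (k : nat) : R := a (inord k.-1).

Definition matrix_of_rows (m n : nat) (rows : seq (seq R)) : 'M[R]_(m, n) :=
  \matrix_(i < m, j < n) (nth [::] rows i)`_j.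

Definition bc_matrix a : 'M[R]_(4, 8) := matrix_of_rows 4 8
  [:: [:: coef a 1; 0; 0; coef a 4; 0; 0; 0; 0];
      [:: 0; coef a 2; coef a 3; 0; 0; 0; 0; 0];
      [:: 0; 0; 0; 0; coef a 5; 0; 0; coef a 8];
      [:: 0; 0; 0; 0; 0; coef a 6; coef a 7; 0]].

Definition dual_bc_matrix a : 'M[R]_(4, 8) := matrix_of_rows 4 8
  [:: [:: coef a 5; 0; 0; coef a 8; 0; 0; 0; 0];
      [:: 0; coef a 6; coef a 7; 0; 0; 0; 0; 0];
      [:: 0; 0; 0; 0; coef a 1; 0; 0; coef a 4];
      [:: 0; 0; 0; 0; 0; coef a 2; coef a 3; 0]].

Definition linearly_equivalent (B B' : 'M[R]_(4, 8)) : Prop :=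
  exists2 S : 'M[R]_4, S \in unitmx & B' = S *m B.

(* [dy] is the derivative of [y] relative to [0, 1] (one-sided at 0 and 1);
   values outside [0, 1] are irrelevant. *)
Definition derivative_on_01 (y dy : R -> R) : Prop :=
  forall x, 0 <= x <= 1 ->
    (y t - y x) / (t - x) @[t --> within `[0, 1]%classic x^'] --> dy x.

Definition bvp_solution a s y : Prop :=
  exists y1 y2 y3 : R -> R,
    [/\ derivative_on_01 y y1, derivative_on_01 y1 y2, derivative_on_01 y2 y3
      & derivative_on_01 y3 (fun x => s ^+ 2 * y x)] /\
    [/\ - coef a 1 * y 0 + coef a 4 * y3 0 = 0,
        - coef a 2 * y1 0 + coef a 3 * y2 0 = 0,
        coef a 5 * y 1 + coef a 8 * y3 1 = 0
      & coef a 6 * y1 1 + coef a 7 * y2 1 = 0].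

Definition positive_eigenvalue a s : Prop :=
  0 < s /\
  exists2 y, bvp_solution a s y & exists2 x, 0 <= x <= 1 & y x != 0.

(* Eigenvalues form a set: each is listed once, whatever the dimension of its
   solution space. *)
Definition first_positive_eigenvalues (n : nat) a (s : 'I_n -> R) : Prop :=
  [/\ forall i, positive_eigenvalue a (s i),
      forall i j : 'I_n, (i < j)%N -> s i < s j
    & forall t, positive_eigenvalue a t ->
        (exists i, t = s i) \/ (forall i, s i < t)].

Definition spectral_matrix (s : 'I_9 -> R) : 'M[R]_(9, 10) :=
  \matrix_(i < 9, j < 10)
    (let t := s i in
     [:: fminus t / t ^+ 2; fminus t; t ^+ 2 * fminus t; fplus t;
         z t / t; t * z t;
         gminus t / Num.sqrt t; Num.sqrt (t ^+ 3) * gminus t;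
         gplus t / Num.sqrt (t ^+ 3); Num.sqrt t * gplus t])`_j.

End Defs.

(* Main.v *)
(* Eliminating the conditions at 0, a number t is an eigenvalue only if a 2x2
   determinant vanishes; expanded, it is a combination of the ten functions in
   the columns of the spectral matrix whose coefficients are, up to an
   invertible linear change, those of the quadratic form w(x) w'(x), where w
   and w' are the linear forms in 4 variables with coefficients
   (a1 a2, a1 a3, a4 a2, a4 a3) and (a5 a6, a5 a7, a8 a6, a8 a7).  Rank 9 makes
   the kernel of the spectral matrix a line, so the quadratic forms of the two
   problems are proportional.  A product of linear forms determines its factors
   up to scaling and order; the two orders give the matrix of the second problem
   and its dual. *)
Require Import Defs.
From HB Require Import structures.
From mathcomp Require Import all_boot all_order all_algebra.
From mathcomp Require Import all_classical all_reals all_analysis.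
From mathcomp Require Import ring lra.
Import Order.TTheory GRing.Theory Num.Theory.
Import numFieldNormedType.Exports.
Local Open Scope classical_set_scope.
Local Open Scope ring_scope.

(** * Differentiation relative to the closed unit interval *)

Lemma near_within_dnbhs {R : realType} (A : set R) (P : R -> Prop) (x : R) :
  (\forall t \near within A x^', P t) ->
  \forall t \near x, t != x -> A t -> P t.
Proof. by []. Qed.

(** The difference quotient has a finite limit, so its product with [t - x] tends to 0. *)
Lemma derivative_on_01_continuous {R : realType} (y dy : R -> R) :
  derivative_on_01 y dy -> {within `[0, 1], continuous y}.
Proof.
move=> yd; apply/subspace_continuousP => x x01.
have x01' : 0 <= x <= 1 by move: x01; rewrite /= in_itv.
have dx : t - x @[t --> within `[0, 1] x^'] --> 0.
  have -> : 0 = x - x by rewrite subrr.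
  by apply: cvgB; [do 2 apply: cvg_within_filter; exact: cvg_id | exact: cvg_cst].
have lim : (y t - y x) / (t - x) * (t - x)
    @[t --> within `[0, 1] x^'] --> (0 : R).
  by have H := cvgM (yd x x01') dx; rewrite mulr0 in H; exact: H.
move/cvgrPdist_lt : lim => lim; apply/cvgrPdist_lt => e e0.
have {lim}ye := near_within_dnbhs _ _ _ (lim e e0).
rewrite near_withinE; near=> t => t01.
have [->|tx] := eqVneq t x; first by rewrite subrr normr0.
have : t != x -> t \in `[0, 1] ->
    `|0 - (y t - y x) / (t - x) * (t - x)| < e by near: t; exact: ye.
move=> /(_ tx t01); rewrite divfK ?subr_eq0//.
by rewrite sub0r opprB.
Unshelve. all: by end_near.
Qed.

(** The slope function of Caratheodory, completed by [dy x] at [x], is continuous there because an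
    interior point has a full neighbourhood inside the interval. *)
Lemma derivative_on_01_is_derive {R : realType} (y dy : R -> R) (x : R) :
  derivative_on_01 y dy -> 0 < x < 1 -> is_derive x 1 y (dy x).
Proof.
move=> yd x01; apply/is_derive1_caratheodory.
have x01' : 0 <= x <= 1 by case/andP: x01 => ? ?; rewrite !ltW.
exists (fun t => if t == x then dy x else (y t - y x) / (t - x)); split.
- move=> t; case: eqVneq => [->|tx]; first by rewrite !subrr mulr0.
  by rewrite divfK ?subr_eq0.
- apply/cvgrPdist_lt => e e0; rewrite eqxx.
  move/cvgrPdist_lt : (yd x x01') => /(_ e e0)/near_within_dnbhs ye.
  near=> t; case: eqVneq => [_|tx]; first by rewrite subrr normr0.
  have t01 : t \in `[0, 1].
    have : t \in `]0, 1[ by near: t; apply: near_in_itvoo; rewrite in_itv.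
    exact: subset_itv_oo_cc.
  by move: tx t01; near: t; exact: ye.
- by rewrite eqxx.
Unshelve. all: by end_near.
Qed.

(** * Krylov functions and their derivatives *)

(* The fundamental solutions of y'''' = k^4 y: [krylov j k] has all derivatives
   of order < 4 at 0 equal to 0 except the j-th, which is 1. *)
Definition krylov {R : realType} (j : nat) (k x : R) : R :=
  match j with
  | 0 => (cosh (k * x) + cos (k * x)) / 2
  | 1 => (sinh (k * x) + sin (k * x)) / (2 * k)
  | 2 => (cosh (k * x) - cos (k * x)) / (2 * k ^+ 2)
  | _ => (sinh (k * x) - sin (k * x)) / (2 * k ^+ 3)
  end.

Arguments krylov : simpl never.

Lemma krylov_at0 {R : realType} (j : nat) (k : R) :
  (j < 4)%N -> krylov j k 0 = (j == 0)%:R.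
Proof.
rewrite /krylov; case: j => [|[|[|[|//]]]] _ /=;
  rewrite mulr0 /cosh /sinh oppr0 expR0 ?cos0 ?sin0 ?subrr ?addr0 ?mul0r//.
all: by rewrite ?[X in X - _]mulfV ?subrr ?mul0r ?mulfV.
Qed.

Lemma is_derive_cosh {R : realType} (x : R) : is_derive x 1 (@cosh R) (sinh x).
Proof.
rewrite (_ : @cosh R = 2^-1 \*: ((expR : R -> R) + (expR \o -%R))); last first.
  by apply/funext => t; rewrite /cosh mulrC.
apply: is_derive_eq; rewrite /sinh /GRing.scale/=; lra.
Qed.

Lemma is_derive_sinh {R : realType} (x : R) : is_derive x 1 (@sinh R) (cosh x).
Proof.
rewrite (_ : @sinh R = 2^-1 \*: ((expR : R -> R) - (expR \o -%R))); last first.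
  by apply/funext => t; rewrite /sinh mulrC.
apply: is_derive_eq; rewrite /cosh /GRing.scale/=; lra.
Qed.

Section krylov_derive.
Context {R : realType} (k x : R).
Hypothesis k0 : k != 0.

Let dk : is_derive x 1 ( *%R k) k.
Proof.
have : is_derive x (1 : R) (k \*: (id : R -> R)) k.
  by apply: is_derive_eq; rewrite /GRing.scale/= mulr1.
by [].
Qed.

Let dcosh := is_derive_cosh (k * x).
Let dsinh := is_derive_sinh (k * x).

Let dcos_k : is_derive x 1 (cos \o *%R k) (- sin (k * x) * k).
Proof. exact: is_derive1_comp. Qed.
Let dsin_k : is_derive x 1 (sin \o *%R k) (cos (k * x) * k).
Proof. exact: is_derive1_comp. Qed.
Let dcosh_k : is_derive x 1 (@cosh R \o *%R k) (sinh (k * x) * k).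
Proof. exact: is_derive1_comp. Qed.
Let dsinh_k : is_derive x 1 (@sinh R \o *%R k) (cosh (k * x) * k).
Proof. exact: is_derive1_comp. Qed.

Lemma is_derive_krylov0 : is_derive x 1 (krylov 0 k) (k ^+ 4 * krylov 3 k x).
Proof.
rewrite (_ : krylov 0 k = 2^-1 \*: ((@cosh R \o *%R k) + (cos \o *%R k))); last first.
  by apply/funext => t; rewrite /krylov /= mulrC.
by apply: is_derive_eq; rewrite /krylov /GRing.scale/= /cosh /sinh; field.
Qed.

Lemma is_derive_krylov1 : is_derive x 1 (krylov 1 k) (krylov 0 k x).
Proof.
rewrite (_ : krylov 1 k =
  (2 * k)^-1 \*: ((@sinh R \o *%R k) + (sin \o *%R k))); last first.
  by apply/funext => t; rewrite /krylov /= mulrC.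
by apply: is_derive_eq; rewrite /krylov /GRing.scale/= /cosh /sinh; field.
Qed.

Lemma is_derive_krylov2 : is_derive x 1 (krylov 2 k) (krylov 1 k x).
Proof.
rewrite (_ : krylov 2 k =
  (2 * k ^+ 2)^-1 \*: ((@cosh R \o *%R k) - (cos \o *%R k))); last first.
  by apply/funext => t; rewrite /krylov /= mulrC.
by apply: is_derive_eq; rewrite /krylov /GRing.scale/= /cosh /sinh; field.
Qed.

Lemma is_derive_krylov3 : is_derive x 1 (krylov 3 k) (krylov 2 k x).
Proof.
rewrite (_ : krylov 3 k =
  (2 * k ^+ 3)^-1 \*: ((@sinh R \o *%R k) - (sin \o *%R k))); last first.
  by apply/funext => t; rewrite /krylov /= mulrC.
by apply: is_derive_eq; rewrite /krylov /GRing.scale/= /cosh /sinh; field.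
Qed.

End krylov_derive.

(** * Solutions expressed by their data at 0 *)

(** The functions [f], ..., [f3] solve the adjoint first-order system, so the derivative of the sum
    telescopes to 0 in the open interval; continuity extends constancy to the endpoints. This takes
    the place of a uniqueness theorem for the equation. *)
Lemma lagrange_identity {R : realType} (c : R) (y y1 y2 y3 f f1 f2 f3 : R -> R) :
  derivative_on_01 y y1 -> derivative_on_01 y1 y2 -> derivative_on_01 y2 y3 ->
  derivative_on_01 y3 (fun x => c * y x) ->
  (forall t, is_derive (t : R) 1 f3 (- f2 t)) ->
  (forall t, is_derive (t : R) 1 f2 (- f1 t)) ->
  (forall t, is_derive (t : R) 1 f1 (- f t)) ->
  (forall t, is_derive (t : R) 1 f (- (c * f3 t))) ->
  forall x, 0 <= x <= 1 ->
  y x * f x + y1 x * f1 x + y2 x * f2 x + y3 x * f3 x =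
  y 0 * f 0 + y1 0 * f1 0 + y2 0 * f2 0 + y3 0 * f3 0.
Proof.
move=> d0 d1 d2 d3 df3 df2 df1 df x /andP[x0 x1].
pose E : R -> R := y * f + y1 * f1 + y2 * f2 + y3 * f3.
have dE (t : R) : t \in `]0, 1[ -> is_derive t 1 E 0.
  rewrite in_itv/= => t01.
  have e0 := is_deriveM (derivative_on_01_is_derive _ _ _ d0 t01) (df t).
  have e1 := is_deriveM (derivative_on_01_is_derive _ _ _ d1 t01) (df1 t).
  have e2 := is_deriveM (derivative_on_01_is_derive _ _ _ d2 t01) (df2 t).
  have e3 := is_deriveM (derivative_on_01_is_derive _ _ _ d3 t01) (df3 t).
  apply: (is_derive_eq (is_deriveD
    (is_deriveD (is_deriveD e0 e1) e2) e3)).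
  by rewrite /GRing.scale/=; ring.
have cE : {within `[0, 1], continuous E}.
  have cf g (dg : R -> R) : (forall t : R, is_derive t 1 g (dg t)) ->
      {within `[0, 1], continuous g}.
    move=> gd; apply: continuous_subspaceT => t.
    by apply/differentiable_continuous/derivable1_diffP; have [] := gd t.
  have cM (g h : R -> R) : {within `[0, 1], continuous g} ->
      {within `[0, 1], continuous h} -> {within `[0, 1], continuous (g * h)}.
    by move=> gc hc t; apply: cvgM; [exact: gc|exact: hc].
  do 3 ?[apply: within_continuousD];
    apply: cM (derivative_on_01_continuous _ _ _) (cf _ _ _); eassumption.
suff : E x = E 0 by [].
clearbody E.
have dEx (t : R) : t \in `]0, x[ -> is_derive t 1 E 0.
  by move=> t0x; apply: dE; move: t0x; rewrite !in_itv/=; lra.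
have cEx : {within `[0, x], continuous E}.
  by apply: continuous_subspaceW cE => t; rewrite /= !in_itv/=; lra.
have [t _] := MVT_segment x0 dEx cEx.
by rewrite mul0r => /eqP; rewrite subr_eq0 => /eqP.
Qed.

(** Pair the solution with [krylov j k (x - t)]: reversing the argument produces the signs of the
    adjoint system. At [t = x] only [y x] survives, and [t = 0] gives the right-hand side. *)
Lemma derivative_on_01_krylov {R : realType} (k : R) (y y1 y2 y3 : R -> R) :
  k != 0 ->
  derivative_on_01 y y1 -> derivative_on_01 y1 y2 -> derivative_on_01 y2 y3 ->
  derivative_on_01 y3 (fun x => k ^+ 4 * y x) ->
  forall x, 0 <= x <= 1 ->
  y x = krylov 0 k x * y 0 + krylov 1 k x * y1 0
      + krylov 2 k x * y2 0 + krylov 3 k x * y3 0.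
Proof.
move=> k0 d0 d1 d2 d3 x x01.
have dsub (t : R) : is_derive t 1 (fun t => x - t) (- 1).
  have : is_derive t 1 (cst x - (id : R -> R)) (- 1).
    by apply: is_derive_eq; rewrite sub0r.
  by [].
have dkc j (t u : R) : is_derive (x - t) 1 (krylov j k) u ->
    is_derive t 1 (krylov j k \o (fun t => x - t)) (- u).
  by move=> ?; rewrite -mulrN1; exact: is_derive1_comp.
have := lagrange_identity _ _ _ _ _ _ _ _ _ d0 d1 d2 d3
  (fun t => dkc _ t _ (is_derive_krylov3 k (x - t) k0))
  (fun t => dkc _ t _ (is_derive_krylov2 k (x - t) k0))
  (fun t => dkc _ t _ (is_derive_krylov1 k (x - t) k0))
  (fun t => dkc _ t _ (is_derive_krylov0 k (x - t) k0)) x x01.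
rewrite /= subrr subr0 !krylov_at0//= !mulr0 !addr0 mulr1 => ->; ring.
Qed.

Lemma cosh2_sinh2 {R : realType} (x : R) : cosh x ^+ 2 - sinh x ^+ 2 = 1.
Proof.
rewrite /cosh /sinh (_ : _ - _ = expR x * expR (- x)); last by field.
by rewrite -expRD subrr expR0.
Qed.

(** * Minors of the transfer matrix from 0 to 1 *)

Section krylov_minors.
Context {R : realType} (t : R).
Hypothesis t0 : 0 < t.
Let k := Num.sqrt t.
Let K j := krylov j k 1.

Let k0 : k != 0. Proof. by rewrite gt_eqF// sqrtr_gt0. Qed.

(** Like the next five expressions, this is up to sign a 2x2 minor of the matrix that carries the
    values of a solution and its first three derivatives from 0 to 1. *)
Lemma krylov_minor_11 : K 3 * K 1 - K 2 ^+ 2 = - fminus t / k ^+ 4.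
Proof.
rewrite /K /krylov /fminus mulr1 -/k.
have hs : sinh k ^+ 2 = cosh k ^+ 2 - 1 by rewrite -(cosh2_sinh2 k); ring.
have s2 := sin2cos2 k.
transitivity ((sinh k ^+ 2 - sin k ^+ 2 - (cosh k - cos k) ^+ 2) / (4 * k ^+ 4)).
  by field.
by rewrite hs s2; field.
Qed.

Lemma krylov_minor_22 :
  k ^+ 4 * K 3 ^+ 2 - K 1 ^+ 2 = - (2 * z t) / k ^+ 2.
Proof. by rewrite /K /krylov /z mulr1 -/k; field. Qed.

Lemma krylov_minor_12 : K 0 * K 3 - K 1 * K 2 = gplus t / k ^+ 3.
Proof. by rewrite /K /krylov /gplus mulr1 -/k; field. Qed.

Lemma krylov_minor_13 : K 0 * K 1 - k ^+ 4 * K 2 * K 3 = - gminus t / k.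
Proof. by rewrite /K /krylov /gminus mulr1 -/k; field. Qed.

Lemma krylov_minor_14 : K 0 ^+ 2 - k ^+ 4 * K 1 * K 3 = fplus t.
Proof.
rewrite /K /krylov /fplus mulr1 -/k.
have hs : sinh k ^+ 2 = cosh k ^+ 2 - 1 by rewrite -(cosh2_sinh2 k); ring.
have s2 := sin2cos2 k.
transitivity (((cosh k + cos k) ^+ 2 - sinh k ^+ 2 + sin k ^+ 2) / 4).
  by field.
by rewrite hs s2; field.
Qed.

Lemma krylov_minor_23 : K 0 ^+ 2 - k ^+ 4 * K 2 ^+ 2 = fplus t - fminus t.
Proof. by rewrite /K /krylov /fplus /fminus mulr1 -/k; field. Qed.

End krylov_minors.

(** * The characteristic equation *)

Definition tensor {R : realType} (u v : bool -> R) (p : bool * bool) : R :=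
  u p.1 * v p.2.

(** In all uses [true] selects the coefficient of the lower derivative in a boundary condition and
    [false] that of the higher one. *)
Definition end_row {R : realType} (a : 'I_8 -> R) (i j : nat) (b : bool) : R :=
  if b then coef a i else coef a j.

Definition left_tensor {R : realType} (a : 'I_8 -> R) : bool * bool -> R :=
  tensor (end_row a 1 4) (end_row a 2 3).

Definition right_tensor {R : realType} (a : 'I_8 -> R) : bool * bool -> R :=
  tensor (end_row a 5 8) (end_row a 6 7).

(* The coefficients of the characteristic determinant in the ten functions of
   the spectral matrix: a linear reparametrization of the symmetric product of
   [w] and [w'], where for instance [w (true, false)] is a_1 a_3. *)
Definition char_coef {R : realType} (w w' : bool * bool -> R) : 'cV[R]_10 :=
  \col_j (let s p q := w p * w' q + w q * w' p in
    let a12 := (true, true) in let a13 := (true, false) in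
    let a42 := (false, true) in let a43 := (false, false) in
    [:: - (w a12 * w' a12); - s a13 a42; - (w a43 * w' a43);
        s a12 a43 + s a13 a42; - (2 * (w a13 * w' a13)); 2 * (w a42 * w' a42);
        - s a12 a42; - s a42 a43; s a12 a13; s a13 a43])`_j.

Lemma colinear2 {F : fieldType} (p q x y : F) :
  (p != 0) || (q != 0) -> p * x = q * y ->
  exists c, x = c * q /\ y = c * p.
Proof.
case: (eqVneq p 0) => /= [-> q0|p0 _] e.
  exists (x / q); split; first by rewrite divfK.
  by move/esym/eqP: e; rewrite mul0r mulf_eq0 (negPf q0) => /eqP ->; rewrite mulr0.
exists (y / p); rewrite divfK//; split=> //.
by apply: (mulfI p0); rewrite e; field.
Qed.

Lemma det2_eq0 {F : fieldType} (m11 m12 m21 m22 x y : F) :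
  m11 * x + m12 * y = 0 -> m21 * x + m22 * y = 0 -> (x != 0) || (y != 0) ->
  m11 * m22 - m12 * m21 = 0.
Proof.
move=> e1 e2 /orP[] ne; apply: (mulIf ne); rewrite mul0r.
  transitivity (m22 * (m11 * x + m12 * y) - m12 * (m21 * x + m22 * y)); first ring.
  by rewrite e1 e2 !mulr0 subrr.
transitivity (m11 * (m21 * x + m22 * y) - m21 * (m11 * x + m12 * y)); first ring.
by rewrite e1 e2 !mulr0 subrr.
Qed.

Lemma positive_eigenvalue_char {R : realType} (a : 'I_8 -> R) (t : R) :
  (coef a 1 != 0) || (coef a 4 != 0) -> (coef a 2 != 0) || (coef a 3 != 0) ->
  positive_eigenvalue a t ->
  \sum_(j < 10) ([:: fminus t / t ^+ 2; fminus t; t ^+ 2 * fminus t; fplus t;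
         z t / t; t * z t;
         gminus t / Num.sqrt t; Num.sqrt (t ^+ 3) * gminus t;
         gplus t / Num.sqrt (t ^+ 3); Num.sqrt t * gplus t])`_j
    * char_coef (left_tensor a) (right_tensor a) j 0 = 0.
Proof.
move=> a14 a23 [t0 [y [y1 [y2 [y3 [[d0 d1 d2 d3] [b1 b2 b3 b4]]]]] [x x01 yx]]].
have km11 := krylov_minor_11 t t0; have km22 := krylov_minor_22 t t0.
have km12 := krylov_minor_12 t t0; have km13 := krylov_minor_13 t t0.
have km14 := krylov_minor_14 t t0; have km23 := krylov_minor_23 t t0.
have k0 : Num.sqrt t != 0 by rewrite gt_eqF// sqrtr_gt0.
have tk : t = Num.sqrt t ^+ 2 by rewrite sqr_sqrtr// ltW.
have tk3 : Num.sqrt (t ^+ 3) = Num.sqrt t ^+ 3.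
  by rewrite {1}tk exprAC sqrtr_sqr ger0_norm ?exprn_ge0 ?sqrtr_ge0.
set k := Num.sqrt t in k0 tk tk3 km11 km22 km12 km13 km14 km23 *.
have d3' : derivative_on_01 y3 (fun x => k ^+ 4 * y x).
  by rewrite (_ : k ^+ 4 = t ^+ 2)// tk -exprM.
have dZ f g c : derivative_on_01 f g ->
    derivative_on_01 (fun x : R => c * f x) (fun x => c * g x).
  move=> fg u u01; rewrite (_ : (fun _ => _) =
      (fun v => c * ((f v - f u) / (v - u)))); last first.
    by apply/funext => v; rewrite -mulrBr mulrA.
  by apply: cvgMl_tmp; exact: fg.
(* Scaling continues the chain of derivatives beyond [y3], so [y1], [y2] and [y3] solve the same
   equation and the Krylov formula also gives their values at 1. *)
have d4 := dZ _ _ (k ^+ 4) d0; have d5 := dZ _ _ (k ^+ 4) d1.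
have d6 := dZ _ _ (k ^+ 4) d2.
have kry x' := derivative_on_01_krylov k _ _ _ _ k0 d0 d1 d2 d3' x'.
have I1 : 0 <= (1 : R) <= 1 by rewrite ler01 lexx.
have := derivative_on_01_krylov k _ _ _ _ k0 d2 d3' d4 d5 1 I1.
have := derivative_on_01_krylov k _ _ _ _ k0 d1 d2 d3' d4 1 I1.
have := derivative_on_01_krylov k _ _ _ _ k0 d3' d4 d5 d6 1 I1.
have := kry 1 I1.
move=> e0 e3 e1 e2.
(* Each condition at 0 confines a pair of initial values to a line; [al] and [be] are the two
   parameters that remain. *)
have [al [y0al y3al]] : exists c, y 0 = c * coef a 4 /\ y3 0 = c * coef a 1.
  apply: colinear2 => //; apply/eqP; rewrite -subr_eq0 -oppr_eq0.
  by apply/eqP; rewrite -[RHS]b1; ring.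
have [be [y1be y2be]] : exists c, y1 0 = c * coef a 3 /\ y2 0 = c * coef a 2.
  apply: colinear2 => //; apply/eqP; rewrite -subr_eq0 -oppr_eq0.
  by apply/eqP; rewrite -[RHS]b2; ring.
(* If both parameters vanished, all four initial values would be 0, and so would [y]. *)
have albe : (al != 0) || (be != 0).
  apply: contraNT yx; rewrite negb_or !negbK => /andP[/eqP al0 /eqP be0].
  by rewrite kry// y0al y3al y1be y2be al0 be0; apply/eqP; ring.
rewrite e0 e3 y0al y1be y2be y3al in b3.
rewrite e1 e2 y0al y1be y2be y3al in b4.
set K0 := krylov 0 k 1 in b3 b4 km11 km22 km12 km13 km14 km23.
set K1 := krylov 1 k 1 in b3 b4 km11 km22 km12 km13 km14 km23.
set K2 := krylov 2 k 1 in b3 b4 km11 km22 km12 km13 km14 km23.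
set K3 := krylov 3 k 1 in b3 b4 km11 km22 km12 km13 km14 km23.
set a1 := coef a 1 in b3 b4 a14; set a2 := coef a 2 in b3 b4 a23.
set a3 := coef a 3 in b3 b4 a23; set a4 := coef a 4 in b3 b4 a14.
set a5 := coef a 5 in b3 b4; set a6 := coef a 6 in b3 b4.
set a7 := coef a 7 in b3 b4; set a8 := coef a 8 in b3 b4.
(* The conditions at 1 are two homogeneous linear equations in [al] and [be]. *)
have D : (a5 * (a4 * K0 + a1 * K3) + a8 * (a4 * k ^+ 4 * K1 + a1 * K0))
    * (a6 * (a3 * K0 + a2 * K1) + a7 * (a3 * k ^+ 4 * K3 + a2 * K0))
  - (a5 * (a3 * K1 + a2 * K2) + a8 * (a3 * k ^+ 4 * K2 + a2 * k ^+ 4 * K3))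
    * (a6 * (a4 * k ^+ 4 * K3 + a1 * K2) + a7 * (a4 * k ^+ 4 * K2 + a1 * K1))
  = 0.
  apply: (@det2_eq0 _ _ _ _ _ al be) => //.
    by rewrite -[RHS]b3; ring.
  by rewrite -[RHS]b4; ring.
(* Collecting products of the coefficients leaves only the six minors computed above. *)
have {}D :
    (a1 * a2 * a5 * a6 + k ^+ 8 * (a4 * a3 * a8 * a7)) * (K3 * K1 - K2 ^+ 2)
  + (a1 * a3 * a5 * a7 - k ^+ 4 * (a4 * a2 * a8 * a6))
    * (k ^+ 4 * K3 ^+ 2 - K1 ^+ 2)
  + (a1 * a2 * a5 * a7 + a1 * a3 * a5 * a6
     + k ^+ 4 * (a1 * a3 * a8 * a7 + a4 * a3 * a5 * a7)) * (K0 * K3 - K1 * K2)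
  + (a1 * a2 * a8 * a6 + a4 * a2 * a5 * a6
     + k ^+ 4 * (a4 * a2 * a8 * a7 + a4 * a3 * a8 * a6))
    * (K0 * K1 - k ^+ 4 * K2 * K3)
  + (a1 * a2 * a8 * a7 + a4 * a3 * a5 * a6) * (K0 ^+ 2 - k ^+ 4 * K1 * K3)
  + (a1 * a3 * a8 * a6 + a4 * a2 * a5 * a7) * (K0 ^+ 2 - k ^+ 4 * K2 ^+ 2) = 0.
  by rewrite -[RHS]D; ring.
rewrite km11 km22 km12 km13 km14 km23 in D.
rewrite -[RHS]D !big_ord_recl big_ord0 !mxE /= /left_tensor /right_tensor /tensor /=.
rewrite -/a1 -/a2 -/a3 -/a4 -/a5 -/a6 -/a7 -/a8 tk3.
(* With the five functions made opaque and [t] replaced by [k ^+ 2], the claim is a rational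
   identity. *)
move: (fplus t) (fminus t) (z t) (gplus t) (gminus t) => fp fm zt gp gm.
by rewrite tk; field.
Qed.

(** * Products of linear forms *)

Section linear_forms.
Context {F : fieldType} {I : finType}.
Implicit Types (w v x : I -> F).

Definition form w x : F := \sum_i w i * x i.

Lemma formD w x y : form w (fun i => x i + y i) = form w x + form w y.
Proof. by rewrite /form -big_split; apply: eq_bigr => i _; rewrite mulrDr. Qed.

Lemma form_delta w i : form w (fun j => (j == i)%:R) = w i.
Proof.
rewrite /form (bigD1 i)//= eqxx mulr1 big1 ?addr0// => j /negPf ->.
by rewrite mulr0.
Qed.

(** If [x] and [y] witness that neither form vanishes on [S], each lies in the kernel of the other
    form, so [x + y] violates the assumption. The set [S] will be the whole space or the kernel of a
    form. *)
Lemma form_mul_eq0 (S : (I -> F) -> Prop) w v :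
  (forall x y, S x -> S y -> S (fun i => x i + y i)) ->
  (forall x, S x -> form w x * form v x = 0) ->
  (forall x, S x -> form w x = 0) \/ (forall x, S x -> form v x = 0).
Proof.
move=> SD Swv; apply: contrapT => /not_orP[/existsNP[x] /not_implyP[Sx /eqP wx]].
move=> /existsNP[y] /not_implyP[Sy /eqP vy].
have /eqP := Swv x Sx; rewrite mulf_eq0 (negPf wx)/= => /eqP vx.
have /eqP := Swv y Sy; rewrite mulf_eq0 (negPf vy) orbF => /eqP wy.
have /eqP := Swv _ (SD x y Sx Sy); rewrite !formD vx wy addr0 add0r.
by rewrite mulf_eq0 (negPf wx) (negPf vy).
Qed.

(** Test on the vector with [w i] at place [j] and [- w j] at place [i], which lies in the kernel of
    [w]. *)
Lemma form_ker_colinear w v : (exists i, w i != 0) ->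
  (forall x, form w x = 0 -> form v x = 0) ->
  exists c, forall i, v i = c * w i.
Proof.
move=> [i wi] wv; exists (v i / w i) => j.
pose x l := w i * (l == j)%:R + - w j * (l == i)%:R.
have formx u : form u x = w i * u j - w j * u i.
  rewrite formD -(form_delta u j) -(form_delta u i) /form !mulr_sumr -sumrN.
  congr (_ + _); apply: eq_bigr => l _; ring.
have := wv x; rewrite !formx mulrC subrr => /(_ erefl)/eqP.
by rewrite subr_eq0 => /eqP e; apply: (mulfI wi); rewrite e; field.
Qed.

(** The product of [w] with [w' - c v'] vanishes identically and [w] does not; then [c] is nonzero
    because [w'] is. *)
Lemma form_mul_cancel w w' v' c : (exists i, w i != 0) -> (exists i, w' i != 0) ->
  (forall x, form w x * form w' x = c * form w x * form v' x) ->
  c != 0 /\ forall i, w' i = c * v' i.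
Proof.
move=> [i wi] [i' wi'] e.
pose u i := w' i - c * v' i.
have formu x : form u x = form w' x - c * form v' x.
  rewrite /form mulr_sumr -sumrB; apply: eq_bigr => l _; rewrite /u; ring.
have [//|x _|w0|u0] := @form_mul_eq0 (fun _ => True) w u.
- by rewrite formu mulrBr e; ring.
- by move: wi; rewrite -form_delta w0 ?eqxx.
have w'v' j : w' j = c * v' j.
  by apply/eqP; rewrite -subr_eq0 -/(u j) -(form_delta u) u0.
split=> //; apply: contraNneq wi' => c0; by rewrite w'v' c0 mul0r.
Qed.

(** A nonzero linear form is prime: on the kernel of [w] the product of [v] and [v'] vanishes, so
    one of them is a multiple of [w], and [w] can be cancelled. *)
Lemma form_mul_unique w w' v v' : (exists i, w i != 0) -> (exists i, w' i != 0) ->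
  (forall x, form w x * form w' x = form v x * form v' x) ->
  exists2 c, c != 0 &
    (forall i, v i = c * w i) /\ (forall i, w' i = c * v' i) \/
    (forall i, v' i = c * w i) /\ (forall i, w' i = c * v i).
Proof.
have formZ u c u' x : (forall i, u' i = c * u i) -> form u' x = c * form u x.
  move=> uc; rewrite /form mulr_sumr; apply: eq_bigr => i _.
  by rewrite uc mulrA.
move=> w0 w'0 e.
have [x y wx wy|x wx|vker|vker] := @form_mul_eq0 (fun x => form w x = 0) v v'.
- by rewrite formD wx wy addr0.
- by rewrite -e wx mul0r.
- have [c vc] := form_ker_colinear w v w0 vker.
  have [|c0 w'c] := form_mul_cancel w w' v' c w0 w'0.
    by move=> x; rewrite e (formZ w c).
  by exists c => //; left.
- have [c vc] := form_ker_colinear w v' w0 vker.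
  have [|c0 w'c] := form_mul_cancel w w' v c w0 w'0.
    by move=> x; rewrite e (formZ w c v')// mulrC.
  by exists c => //; right.
Qed.

End linear_forms.

(** * Tensors and the coefficients of the quadratic form *)

Lemma tensor_neq0 {R : realType} (u v : bool -> R) :
  (exists i, u i != 0) -> (exists i, v i != 0) -> exists p, tensor u v p != 0.
Proof. by move=> [i ui] [j vj]; exists (i, j); rewrite mulf_neq0. Qed.

(** The row and the column through a nonzero entry [(i, j)] recover the two factors up to scale. *)
Lemma tensor_colinear {R : realType} (u v u' v' : bool -> R) (c : R) :
  (exists i, u i != 0) -> (exists i, v i != 0) -> c != 0 ->
  (forall p, tensor u' v' p = c * tensor u v p) ->
  (exists2 m, m != 0 & forall i, u' i = m * u i) /\
  (exists2 m, m != 0 & forall i, v' i = m * v i).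
Proof.
move=> [i ui] [j vj] c0 e.
have : u' i * v' j != 0 by rewrite [_ * _](e (i, j)) !mulf_neq0.
rewrite mulf_eq0 negb_or => /andP[u'i v'j]; split.
  exists (c * v j / v' j); first by rewrite !mulf_neq0 ?invr_neq0.
  by move=> l; apply: (mulIf v'j); rewrite [_ * _](e (l, j)) /tensor/=; field.
exists (c * u i / u' i); first by rewrite !mulf_neq0 ?invr_neq0.
by move=> l; apply: (mulfI u'i); rewrite [_ * _](e (i, l)) /tensor/=; field.
Qed.

(** The quadratic form depends only on [char_coef], and linearly. Entry 3 mixes two coefficients
    because one minor equals the difference of [fplus] and [fminus]; adding entry 1 separates
    them. *)
Lemma form_mul_char_coef {R : realType} (w w' x : bool * bool -> R) :
  form w x * form w' x =
  let C j := char_coef w w' (inord j) 0 in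
  let x12 := x (true, true) in let x13 := x (true, false) in
  let x42 := x (false, true) in let x43 := x (false, false) in
  - C 0 * x12 ^+ 2 - C 4 / 2 * x13 ^+ 2 + C 5 / 2 * x42 ^+ 2 - C 2 * x43 ^+ 2
  + C 8 * (x12 * x13) - C 6 * (x12 * x42) + (C 3 + C 1) * (x12 * x43)
  - C 1 * (x13 * x42) + C 9 * (x13 * x43) - C 7 * (x42 * x43).
Proof.
have formE v : form v x = v (true, true) * x (true, true)
    + v (true, false) * x (true, false) + v (false, true) * x (false, true)
    + v (false, false) * x (false, false).
  rewrite /form; transitivity (\sum_i \sum_j v (i, j) * x (i, j)).
    by rewrite pair_bigA; apply: eq_bigr => -[].
  by rewrite !big_bool/= addrA.
by rewrite /= !mxE !inordK//= !formE; field.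
Qed.

(** * Kernels of corank one and boundary matrices *)

(** By rank-nullity the kernel has dimension 1, so [y] spans it. Transposes appear because [kermx]
    is a left kernel. *)
Lemma ker_rank1_colinear {F : fieldType} (m n : nat) (M : 'M[F]_(m, n))
    (x y : 'cV[F]_n) :
  n = (\rank M).+1 -> M *m x = 0 -> M *m y = 0 -> y != 0 ->
  exists c, x = c *: y.
Proof.
move=> nM Mx My y0.
have ker (u : 'cV_n) : M *m u = 0 -> (u^T <= kermx M^T)%MS.
  by move=> Mu; apply/sub_kermxP; rewrite -trmx_mul Mu trmx0.
have yker : (kermx M^T <= y^T)%MS.
  rewrite -(geq_leqif (mxrank_leqif_sup (ker y My))).
  rewrite mxrank_ker mxrank_tr {1}nM subSnn lt0n mxrank_eq0.
  by apply: contra y0 => /eqP yT; rewrite -(trmxK y) yT trmx0.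
have /sub_rVP[c xc] := submx_trans (ker x Mx) yker.
by exists c; rewrite -(trmxK x) xc linearZ/= trmxK.
Qed.

Lemma row_neq0 {F : fieldType} (m n : nat) (B : 'M[F]_(m, n)) (i : 'I_m) :
  \rank B = m -> row i B != 0.
Proof.
move=> rB; apply/eqP => rowi.
have : row_free B by rewrite /row_free rB.
move/row_free_inj => /(_ 1 (delta_mx 0 i) 0); rewrite mul0mx -rowE rowi.
by move=> /(_ erefl)/matrixP/(_ 0 i)/eqP; rewrite !mxE !eqxx/= oner_eq0.
Qed.

Lemma linearly_equivalent_scale {R : realType} (B B' : 'M[R]_(4, 8)) :
  (forall i, exists2 m, m != 0 & forall j, B' i j = m * B i j) ->
  linearly_equivalent B B'.
Proof.
move=> BB'.
have /choice[d dP] : forall i, exists m,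
    m != 0 /\ forall j, B' i j = m * B i j.
  by move=> i; have [m m0 mB] := BB' i; exists m.
exists (diag_mx (\row_i d i)).
  rewrite unitmxE det_diag unitfE; apply/prodf_neq0 => i _.
  by rewrite mxE; have [] := dP i.
by apply/matrixP => i j; rewrite mul_diag_mx !mxE; have [_ ->] := dP i.
Qed.

(** Full row rank excludes a zero row. *)
Lemma bc_matrix_end_rows {R : realType} (a : 'I_8 -> R) :
  \rank (bc_matrix a) = 4%N ->
  [/\ exists i, end_row a 1 4 i != 0, exists i, end_row a 2 3 i != 0,
      exists i, end_row a 5 8 i != 0 & exists i, end_row a 6 7 i != 0].
Proof.
move=> ra.
have nz p q (i : 'I_4) : (coef a p = 0 -> coef a q = 0 -> row i (bc_matrix a) = 0) ->
    exists b, end_row a p q b != 0.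
  move=> pq0; case: (eqVneq (coef a p) 0) => [p0|]; last by exists true.
  case: (eqVneq (coef a q) 0) => [q0|]; last by exists false.
  by have := row_neq0 _ _ _ i ra; rewrite pq0 ?eqxx.
split; [apply: (nz _ _ (inord 0)) | apply: (nz _ _ (inord 1))
       | apply: (nz _ _ (inord 2)) | apply: (nz _ _ (inord 3))] => p0 q0;
  apply/rowP => -[[|[|[|[|[|[|[|[|//]]]]]]]] lt8];
  by rewrite !mxE inordK//= ?p0 ?q0.
Qed.

(** * Recovering the boundary conditions *)

Lemma spectral_matrix_char {R : realType} (a : 'I_8 -> R) (s : 'I_9 -> R) :
  \rank (bc_matrix a) = 4%N -> (forall i, positive_eigenvalue a (s i)) ->
  spectral_matrix s *m char_coef (left_tensor a) (right_tensor a) = 0.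
Proof.
move=> /bc_matrix_end_rows[a14 a23 _ _] sa; apply/colP => i; rewrite !mxE.
have some_neq0 p q : (exists b, end_row a p q b != 0) ->
    (coef a p != 0) || (coef a q != 0).
  by case=> -[] h; apply/orP; [left|right].
rewrite -[RHS](positive_eigenvalue_char a (s i) (some_neq0 _ _ a14) (some_neq0 _ _ a23) (sa i)).
by apply: eq_bigr => j _; rewrite mxE.
Qed.

Theorem theorem2 (R : realType) (a : 'I_8 -> R) (s : 'I_9 -> R) :
  (forall k, 0 <= a k) ->
  \rank (bc_matrix a) = 4%N ->
  first_positive_eigenvalues a s ->
  \rank (spectral_matrix s) = 9%N ->
  forall b : 'I_8 -> R,
    (forall k, 0 <= b k) ->
    \rank (bc_matrix b) = 4%N ->
    first_positive_eigenvalues b s ->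
    linearly_equivalent (bc_matrix a) (bc_matrix b) \/
    linearly_equivalent (bc_matrix a) (dual_bc_matrix b).
Proof.
move=> _ ra [sa _ _] rs b _ rb [sb _ _].
have [a14 a23 a58 a67] := bc_matrix_end_rows a ra.
have [b14 b23 b58 b67] := bc_matrix_end_rows b rb.
(* Zero coefficients would make the product of the two forms vanish, hence one of the forms,
   although each is a tensor of nonzero rows. *)
have char_neq0 (c : 'I_8 -> R) : \rank (bc_matrix c) = 4%N ->
    char_coef (left_tensor c) (right_tensor c) != 0.
  move=> /bc_matrix_end_rows[c14 c23 c58 c67]; apply/eqP => c0.
  have [||w0|w0] := @form_mul_eq0 _ _ (fun _ => True) (left_tensor c) (right_tensor c).
  - by [].
  - by move=> x _; rewrite form_mul_char_coef c0 /= !mxE; ring.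
  - have [p] := tensor_neq0 _ _ c14 c23.
    by rewrite -[tensor _ _ p](form_delta (left_tensor c)) w0 ?eqxx.
  - have [p] := tensor_neq0 _ _ c58 c67.
    by rewrite -[tensor _ _ p](form_delta (right_tensor c)) w0 ?eqxx.
have [l abl] := ker_rank1_colinear _ _ (spectral_matrix s) _ _
  (esym (congr1 S rs)) (spectral_matrix_char a s ra sa)
  (spectral_matrix_char b s rb sb) (char_neq0 b rb).
have l0 : l != 0.
  by apply: contraNneq (char_neq0 a ra) => l0; rewrite abl l0 scale0r.
(* The factor [l] is absorbed into the left form of [b], turning proportional products into equal
   ones. *)
have eqform x : form (left_tensor a) x * form (right_tensor a) x =
    form (fun p => l * left_tensor b p) x * form (right_tensor b) x.
  have -> : form (fun p => l * left_tensor b p) x = l * form (left_tensor b) x.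
    by rewrite /form mulr_sumr; apply: eq_bigr => p _; rewrite /= -mulrA.
  by rewrite -mulrA !form_mul_char_coef abl /= !mxE; ring.
have [c c0 [[bl br]|[br bl]]] := form_mul_unique (left_tensor a) (right_tensor a) _ _
  (tensor_neq0 _ _ a14 a23) (tensor_neq0 _ _ a58 a67) eqform; [left|right];
  apply: linearly_equivalent_scale.
(* Same order of factors: each row of [b] is a multiple of the row of [a] at the same end. *)
- have [||[m1 ? e1] [m2 ? e2]] := tensor_colinear _ _
    (end_row b 1 4) (end_row b 2 3) (c / l) a14 a23.
  + by rewrite mulf_neq0 ?invr_neq0.
  + by move=> p; rewrite -/(left_tensor a p) -/(left_tensor b p) mulrAC -bl; field.
  have [||[m3 ? e3] [m4 ? e4]] := tensor_colinear _ _
    (end_row b 5 8) (end_row b 6 7) c^-1 a58 a67.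
  + by rewrite invr_neq0.
  + by move=> p; rewrite -/(right_tensor a p) -/(right_tensor b p) br; field.
  have := (e1 true, e1 false, (e2 true, e2 false),
           (e3 true, e3 false, (e4 true, e4 false))).
  rewrite /= => E.
  case=> [[|[|[|[|//]]]] lt4]; [exists m1|exists m2|exists m3|exists m4] => //;
    by case=> [[|[|[|[|[|[|[|[|//]]]]]]]] lt8]; rewrite !mxE/= ?E ?mulr0.
(* Exchanged factors: the rows of [b] at 1 match those of [a] at 0 and conversely, which gives the
   dual matrix. *)
- have [||[m1 ? e1] [m2 ? e2]] := tensor_colinear _ _
    (end_row b 5 8) (end_row b 6 7) c a14 a23.
  + by [].
  + by move=> p; rewrite -br.
  have [||[m3 ? e3] [m4 ? e4]] := tensor_colinear _ _
    (end_row b 1 4) (end_row b 2 3) (c * l)^-1 a58 a67.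
  + by rewrite invr_neq0// mulf_neq0.
  + by move=> p; rewrite -/(right_tensor a p) -/(left_tensor b p) bl /=; field; rewrite l0 c0.
  have := (e1 true, e1 false, (e2 true, e2 false),
           (e3 true, e3 false, (e4 true, e4 false))).
  rewrite /= => E.
  case=> [[|[|[|[|//]]]] lt4]; [exists m1|exists m2|exists m3|exists m4] => //;
    by case=> [[|[|[|[|[|[|[|[|//]]]]]]]] lt8]; rewrite !mxE/= ?E ?mulr0.
Qed.
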